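(* Let $G$ be a connected non-complete graph of order $n\geq 16$. If $\delta(G)\geq \frac{n-3}{4}$, then $cfc(G) = 2$.
   Context: All graphs are finite, simple and undirected; $\delta(G)$ is the minimum degree. An edge-coloring of a connected graph (adjacent edges may receive the same color) is a conflict-free connection coloring if every pair of distinct vertices is joined by a path containing at least one color used on exactly one edge of that path. The conflict-free connection number $cfc(G)$ is the smallest number of colors in a conflict-free connection coloring of $G$. *)

(* Defs.v *)
From mathcomp Require Import all_boot all_order all_algebra.
From mathcomp Require Import boolp.

Set Implicit Arguments.
Unset Strict Implicit.
Unset Printing Implicit Defensive.

Record sgraph := SGraph {
  vertex :> finType;
  adj : rel vertex;
  adj_sym : symmetric adj;
  adj_irrefl : irreflexive adj }.

Section Graph.
Variable G : sgraph.
Implicit Types (x y : G) (p : seq G) (c : {set G} -> nat) (k : nat).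

Definition edge_set : {set {set G}} :=
  [set f : {set G} | [exists x, exists y, adj x y && (f == [set x; y])]].

Definition deg x : nat := #|[set y | adj x y]|.

(* The default value #|G| exceeds every degree, so this is the minimum of the
   degrees as soon as G has a vertex. *)
Definition min_deg : nat := \big[minn/#|G|]_(x : G) deg x.

Definition complete : Prop := forall x y, x != y -> adj x y.

Definition connected : Prop := forall x y, connect (@adj G) x y.

Definition simple_path x p y : Prop :=
  [/\ path (@adj G) x p, uniq (x :: p) & last x p = y].

Definition path_edges x p : seq {set G} :=
  pairmap (fun u v => [set u; v]) x p.

Definition conflict_free_path c x p : Prop :=
  exists a : nat, count_mem a [seq c f | f <- path_edges x p] = 1.

(* Colors are natural numbers; the values of a coloring outside edge_set are
   irrelevant. *)
Definition cf_connection_coloring c : Prop :=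
  forall x y, x != y ->
    exists2 p, simple_path x p y & conflict_free_path c x p.

Definition cf_connection_colorable k : Prop :=
  exists2 c, {in edge_set, forall f, c f < k} & cf_connection_coloring c.

Lemma path_edges_cover x p f z :
  f \in path_edges x p -> z \in f -> z \in x :: p.
Proof.
elim: p x => [|u p IH] x //=; rewrite inE => /orP[/eqP->|fp zf].
  by rewrite !inE => /orP[/eqP->|/eqP->]; rewrite eqxx ?orbT.
by rewrite inE (IH u) ?orbT.
Qed.

(* Every connected graph has a conflict-free connection coloring: give
   pairwise distinct colors to the edges. *)
Lemma cf_connection_colorable_ex :
  connected -> exists k, `[< cf_connection_colorable k >].
Proof.
move=> Gconn; exists #|{set G}|; apply/asboolP.
exists (fun f => enum_rank f : nat) => [f _ | x y neq_xy]; first exact: ltn_ord.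
have /connectP[q q_path q_last] := Gconn x y.
case: (shortenP q_path) q_last => p p_path p_uniq _ p_last.
exists p; first by split.
case: p p_path p_uniq p_last => [|u p] p_path p_uniq p_last.
  by rewrite p_last eqxx in neq_xy.
exists (enum_rank [set x; u] : nat) => /=.
rewrite eqxx; congr (_ + _); apply/eqP; rewrite -leqn0 leqNgt -has_count.
apply/hasPn => a /mapP[f fp ->] /=; apply/eqP => /ord_inj/enum_rank_inj f_eq.
move: p_uniq => /= /andP[/negP xNp _]; apply: xNp.
by apply: (path_edges_cover fp); rewrite f_eq !inE eqxx.
Qed.

Definition cfc (Gconn : connected) : nat :=
  ex_minn (cf_connection_colorable_ex Gconn).

End Graph.

(* Main.v *)
Require Import Defs.
From mathcomp Require Import all_boot all_order all_algebra.
From mathcomp Require Import boolp zify lra.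
Import Order.TTheory GRing.Theory Num.Theory.

Set Implicit Arguments.
Unset Strict Implicit.
Unset Printing Implicit Defensive.

(** A set of vertices left by at most three edges has more than delta(G)
    elements, so the degree condition forbids cutting G along bridges into four
    parts: G has at most two bridges.  In a 2-connected graph mark a single
    edge; then any two distinct vertices are joined by a path avoiding the
    marked edge and by a path through it.  Gluing along cut vertices extends
    this to bridgeless graphs, where any two distinct vertices are joined by a
    path with no marked edge and by a path with exactly one.  If there are two
    bridges, mark one of them and not the other; if there is one, mark it.
    Then any two vertices are adjacent or joined by a path with exactly one
    marked edge, and marked/unmarked is the required coloring. *)

(** The premise asks for [connect] rather than [e'], so that [f] may collapse an edge to a point or
    replace it by a detour. *)
Lemma connect_homo (T T' : finType) (e : rel T) (e' : rel T') (f : T -> T') x y :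
    (forall u v, e u v -> connect e' (f u) (f v)) ->
  connect e x y -> connect e' (f x) (f y).
Proof.
move=> fP /connectP[p + ->]; elim: p x => [|u p IH] x //= /andP[xu up].
exact: connect_trans (fP _ _ xu) (IH _ up).
Qed.

Section Graph.
Variable G : sgraph.
Implicit Types (x y a b v : G) (p q : seq G) (W A B : {set G}) (s : pred {set G}).

(** * Edges of concatenated and reversed paths *)

Lemma path_edges_cat x p q :
  path_edges x (p ++ q) = path_edges x p ++ path_edges (last x p) q.
Proof. exact: pairmap_cat. Qed.

Lemma path_edges_rev x p :
  path_edges (last x p) (rev (belast x p)) = rev (path_edges x p).
Proof.
elim: p x => [|u p IH] x //=; rewrite !rev_cons -!cats1 path_edges_cat IH.
congr (_ ++ _) => /=; suff -> : last (last u p) (rev (belast u p)) = u.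
  by rewrite setUC.
by case: p {IH} => [|w p] //=; rewrite rev_cons last_rcons.
Qed.

Lemma uniq_path_edges x p : uniq (x :: p) -> uniq (path_edges x p).
Proof.
elim: p x => [|u p IH] x //= /andP[xp up]; rewrite IH // andbT.
by apply: contraNN xp => /path_edges_cover; apply; rewrite set21.
Qed.

(** * Connectivity of induced subgraphs *)

Definition induced_adj W (u v : G) := [&& u \in W, v \in W & adj u v].

Definition connected_in W := {in W &, forall x y, connect (induced_adj W) x y}.

(** The edge is deleted as an unordered pair, hence in both directions. *)
Definition adj_without W a b (u v : G) :=
  induced_adj W u v && ([set u; v] != [set a; b]).

Definition bridgeless W :=
  {in W &, forall a b, adj a b -> connect (adj_without W a b) a b}.

Lemma induced_adj_sym W : symmetric (induced_adj W).
Proof. by move=> x y; rewrite /induced_adj adj_sym andbCA. Qed.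

Lemma induced_path_sub W x p : path (induced_adj W) x p -> {subset p <= W}.
Proof.
elim: p x => [|u p IH] x //= /andP[/and3P[_ uW _] up] v; rewrite inE.
by case/orP=> [/eqP->//|/(IH _ up)].
Qed.

Lemma induced_pathS W W' x p :
  W \subset W' -> path (induced_adj W) x p -> path (induced_adj W') x p.
Proof.
move=> /subsetP sub; apply: sub_path => u v /and3P[/sub uW /sub vW uv].
by rewrite /induced_adj uW vW.
Qed.

Lemma connect_simple (e : rel G) x y :
  connect e x y -> exists p, [/\ path e x p, uniq (x :: p) & last x p = y].
Proof.
case/connectP=> p ep ->; case/shortenP: ep => q eq uq _; by exists q.
Qed.

Definition vertex_glue W A B v :=
  [/\ A :|: B = W, A :&: B = [set v] &
      forall u w, u \in A -> w \in B -> adj u w -> u = v \/ w = v].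

Lemma vertex_glueC W A B v : vertex_glue W A B v -> vertex_glue W B A v.
Proof.
case=> U I E; split; rewrite 1?setUC 1?setIC // => u w uB wA.
by rewrite adj_sym => /(E _ _ wA uB)[]; [right|left].
Qed.

(* Collapsing the other side onto the common vertex maps walks to walks. *)
Lemma vertex_glue_side W A B v :
    vertex_glue W A B v -> connected_in W -> bridgeless W ->
  connected_in A /\ bridgeless A.
Proof.
case=> U I E cW bW.
have AW x : x \in A -> x \in W by rewrite -U inE => ->.
have BN x : x \in W -> x \notin A -> x \in B.
  by rewrite -U inE => /orP[->|].
have /setIP[vA vB] : v \in A :&: B by rewrite I set11.
pose f x := if x \in A then x else v.
have fE u w : induced_adj W u w ->
    f u = f w \/ [/\ f u = u, f w = w & induced_adj A u w].
  rewrite /f => /and3P[uW wW uw].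
  have [uA|uA] := boolP (u \in A); have [wA|wA] := boolP (w \in A).
  - by right; rewrite /induced_adj uA wA.
  - have [->|wv] := E u w uA (BN w wW wA) uw; first by left.
    by rewrite wv vA in wA.
  - rewrite adj_sym in uw; have [->|uv] := E w u wA (BN u uW uA) uw; first by left.
    by rewrite uv vA in uA.
  - by left.
have fA z : z \in A -> f z = z by rewrite /f => ->.
split=> [x y xA yA | a b aA bA ab].
  rewrite -(fA x xA) -(fA y yA).
  apply: connect_homo (cW _ _ (AW _ xA) (AW _ yA)) => u w.
  by move=> /fE[->//|[-> -> uw]]; exact: connect1.
rewrite -{2}(fA a aA) -{2}(fA b bA).
apply: connect_homo (bW _ _ (AW _ aA) (AW _ bA) ab) => u w.
move=> /andP[/fE[->//|[-> -> uw]] ne].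
by apply: connect1; rewrite /adj_without uw.
Qed.

(** One part is a component of [W :\ v] with [v] added, the other is [W] without that component. Two
    vertices in different components show that both parts are proper, which drives an induction on
    [#|W|]. *)
Lemma not_connected_in_glue W v :
    connected_in W -> v \in W -> ~ connected_in (W :\ v) ->
  exists A B, [/\ vertex_glue W A B v, #|A| < #|W| & #|B| < #|W|].
Proof.
move=> cW vW /existsNP[x /existsNP[y /not_implyP[xW /not_implyP[yW /negP xy]]]].
pose C := [set z in W :\ v | connect (induced_adj (W :\ v)) x z].
have CW : C \subset W by apply/subsetP => z; rewrite !inE => /andP[/andP[]].
have vC : v \notin C by rewrite !inE eqxx.
have xC : x \in C by rewrite inE xW connect0.
have yC : y \notin C by rewrite inE yW.
move: (xW) (yW); rewrite !inE => /andP[xv xW'] /andP[yv yW'].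
exists (v |: C), (W :\: C); split.
- split.
  + apply/setP => z; rewrite !in_setU !in_setD !in_set1.
    have [->|_] := eqVneq z v; first by rewrite vW.
    by have [/(subsetP CW)->|] := boolP (z \in C).
  + apply/setP => z; rewrite !in_setI !in_setU !in_setD !in_set1.
    have [->|_] := eqVneq z v; first by rewrite vW vC.
    by case: (z \in C).
  + move=> u w; rewrite in_setU in_setD in_set1.
    case/orP=> [/eqP->|uC] /andP[wC wW] uw; first by left.
    right; apply: contraNeq wC => wv; move: uC.
    rewrite !inE wv wW => /andP[/andP[uv uW] xu].
    apply: connect_trans xu (connect1 _).
    by rewrite /induced_adj !inE uv uW wv wW.
- apply: proper_card; apply/properP; split.
    by rewrite subUset sub1set vW.
  by exists y; rewrite // in_setU in_set1 negb_or yv.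
- apply: proper_card; apply/properP; split; first exact: subsetDl.
  by exists x; rewrite // in_setD xC.
Qed.

(** The boolean equation says both that [a] and [b] are adjacent and that no other edge crosses. *)
Definition bridge_split W A B a b :=
  [/\ A :|: B = W, A :&: B = set0, a \in A, b \in B &
      {in A & B, forall u w, adj u w = (u == a) && (w == b)}].

Lemma bridge_splitC W A B a b :
  bridge_split W A B a b -> bridge_split W B A b a.
Proof.
case=> U I aA bB E; split; rewrite 1?setUC 1?setIC // => u w uB wA.
by rewrite adj_sym E // andbC.
Qed.

(** Collapsing [B] onto [a] contracts the only crossing edge, so walks in [W] become walks in
    [A]. *)
Lemma bridge_split_side W A B a b :
  bridge_split W A B a b -> connected_in W -> connected_in A.
Proof.
case=> U I aA bB E cW x y xA yA.
have AW z : z \in A -> z \in W by rewrite -U inE => ->.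
pose f z := if z \in A then z else a.
have fA z : z \in A -> f z = z by rewrite /f => ->.
rewrite -(fA x xA) -(fA y yA).
apply: connect_homo (cW _ _ (AW _ xA) (AW _ yA)) => u w.
rewrite /f /induced_adj -U !inE => /and3P[].
case: (boolP (u \in A)) => [uA _|_ /= uB].
  case: (boolP (w \in A)) => [wA _ uw|_ /= wB].
    by apply: connect1; rewrite /induced_adj uA wA.
  by rewrite E // => /andP[/eqP->].
case: (boolP (w \in A)) => [wA _|_ _ _] //.
by rewrite adj_sym E // => /andP[/eqP->].
Qed.

(** [A] collects the vertices reached from [a] once a bridge [a b] is deleted; any other edge
    leaving [A] would enlarge it. *)
Lemma not_bridgeless_split W :
    ~ bridgeless W -> exists A B a b, bridge_split W A B a b.
Proof.
move=> /existsNP[a /existsNP[b]].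
move=> /not_implyP[aW /not_implyP[bW /not_implyP[ab /negP nab]]].
pose A := [set z in W | connect (adj_without W a b) a z].
have aA : a \in A by rewrite inE aW connect0.
have bA : b \notin A by rewrite inE bW.
exists A, (W :\: A), a, b; split=> //.
- apply/setP=> z; rewrite in_setU in_setD.
  have [|] //= := boolP (z \in A); by rewrite inE => /andP[->].
- by apply/setP=> z; rewrite in_setI in_setD in_set0; case: (z \in A).
- by rewrite in_setD bA.
move=> u w uA; rewrite in_setD => /andP[wA wW].
apply/idP/andP => [uw|[/eqP-> /eqP->]] //.
have /eqP E : [set u; w] == [set a; b].
  apply: contraNT wA => ne; move: uA; rewrite !inE wW => /andP[uW au].
  apply: connect_trans au (connect1 _).
  by rewrite /adj_without /induced_adj uW wW uw.
have wa : w != a by apply: contraNneq wA => ->.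
have ub : u != b by apply: contraNneq bA => <-.
have : u \in [set a; b] by rewrite -E set21.
have : w \in [set a; b] by rewrite -E set22.
by rewrite !inE (negbTE wa) (negbTE ub) orbF.
Qed.

(** * Paths through a prescribed edge *)

Definition path_via W (f : {set G}) x y :=
  exists p, [/\ path (induced_adj W) x p, uniq (x :: p), last x p = y
              & f \in path_edges x p].

(* The only hard case is when [z] precedes [f] on the path.  Then the part of
   the path after [z] closes up to a cycle containing [f]; reach that cycle
   from [x] avoiding [z], and follow it to [z] in the direction of [f]. *)
Lemma path_via_step W f x y z :
    connected_in (W :\ z) -> x \in W -> path_via W f x y ->
    induced_adj W y z -> z != x ->
  path_via W f x z.
Proof.
move=> cWz xW [p [pp up lp fp]] yz zx.
have [zp|zp] := boolP (z \in p); last first.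
  exists (rcons p z); split; last by rewrite -cats1 path_edges_cat mem_cat fp.
  - by rewrite rcons_path pp lp.
  - by rewrite -rcons_cons rcons_uniq inE negb_or zx zp.
  - by rewrite last_rcons.
case/splitPr: zp pp up lp fp => p1 p2; rewrite -cat_rcons cat_path last_rcons.
move=> /andP[pp1 pp2] up; rewrite last_cat last_rcons => lp.
rewrite path_edges_cat last_rcons mem_cat => /orP[fp1|fp2].
  exists (rcons p1 z); split=> //; last by rewrite last_rcons.
  by move: up; rewrite -cat_cons cat_uniq => /andP[].
have /and3P[xp2 zp2 up2] : [&& x \notin p2, z \notin p2 & uniq p2].
  move: up; rewrite cat_rcons cons_uniq cat_uniq mem_cat inE !negb_or /=.
  by case/andP=> /and3P[_ _ ->] /and3P[_ _ ->].
have /and3P[yW zW adj_yz] := yz.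
have yNz : y != z by apply: contraTneq adj_yz => ->; rewrite adj_irrefl.
have yp2 : y \in p2.
  case: (p2) lp => [/= zy|u r /= <-]; last exact: mem_last.
  by rewrite zy eqxx in yNz.
have [|q0 [pq0 uq0 lq0]] := @connect_simple (induced_adj (W :\ z)) x y.
  by apply: cWz; rewrite !inE ?yNz // eq_sym zx.
have hq : has (mem p2) q0.
  apply/hasP; exists y => //; move: lq0; case: (q0) => [/= xy|u r <-] /=.
    by rewrite xy yp2 in xp2.
  exact: mem_last.
(* [w] is the first vertex of [q0] on [p2], so up to [w] this path meets the cycle formed by [z],
   [p2] and the edge [y z] only in [w]. *)
case: (split_find hq) uq0 pq0 => w q r wp2 /hasPn qp2 + +; have {}wp2 : w \in p2 := wp2.
rewrite cat_path -cat_cons cat_uniq => /andP[uq _] /andP[pq _].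
have zq : z \notin rcons q w.
  by apply/negP => /(induced_path_sub pq); rewrite !inE eqxx.
have {}pq := induced_pathS (subsetDl W [set z]) pq.
have uniqP t : {subset t <= z :: p2} -> w \notin t -> uniq t ->
    uniq (x :: rcons q w ++ t).
  move=> tz wt ut; rewrite -cat_cons cat_uniq uq ut andbT /=.
  apply/hasPn => u ut'; have := tz _ ut'; rewrite /= inE => /orP[/eqP->|u2].
    by rewrite inE negb_or zx.
  rewrite inE mem_rcons inE !negb_or; apply/and3P; split.
  - by apply: contraNneq xp2 => <-.
  - by apply: contraNneq wt => <-.
  - by apply: contraTN u2 => /qp2.
case/splitPr: wp2 pp2 zp2 up2 fp2 lp uniqP {pp1 up xp2 yp2 qp2} => r1 r2.
rewrite -cat_rcons cat_path path_edges_cat last_cat !last_rcons.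
move=> /andP[pr1 pr2] zr ur fr lr uniqP.
have wz : w != z by apply: contraNneq zq => <-; rewrite mem_rcons inE eqxx.
move: fr; rewrite mem_cat => /orP[] fr.
  (* [f] lies between [z] and [w]: follow the cycle backwards to [z]. *)
  exists (rcons q w ++ rev (belast z (rcons r1 w))); split.
  - rewrite cat_path pq last_rcons -{1}(last_rcons z r1 w) rev_path.
    by rewrite (eq_path (e' := induced_adj W)) // => u v; rewrite induced_adj_sym.
  - apply: uniqP; rewrite belast_rcons ?rev_uniq.
    + move=> u; rewrite mem_rev !inE mem_cat mem_rcons inE => /orP[->//|->].
      by rewrite !orbT.
    + rewrite mem_rev inE negb_or wz /=.
      by move: ur; rewrite cat_uniq rcons_uniq => /andP[/andP[]].
    + rewrite cons_uniq; move: zr ur.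
      rewrite mem_cat mem_rcons inE !negb_or cat_uniq rcons_uniq.
      by case/andP=> /andP[_ ->] _ /andP[/andP[_ ->]].
  - by rewrite belast_rcons rev_cons last_cat last_rcons.
  - rewrite path_edges_cat last_rcons -{2}(last_rcons z r1 w) path_edges_rev.
    by rewrite mem_cat mem_rev fr orbT.
(* [f] lies between [w] and [y]: follow the cycle forwards and close it with [y z]. *)
exists (rcons q w ++ rcons r2 z); split.
- by rewrite cat_path pq last_rcons rcons_path pr2 lr.
- have wr2 : w \notin r2.
    move: ur; rewrite cat_uniq => /and3P[_ /hasPn h _].
    by apply/negP => /h; rewrite mem_rcons inE eqxx.
  apply: uniqP.
  + move=> u; rewrite mem_rcons !inE mem_cat => /orP[->//|->].
    by rewrite !orbT.
  + by rewrite mem_rcons inE negb_or wz.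
  + rewrite rcons_uniq; move: zr ur; rewrite mem_cat negb_or cat_uniq.
    by case/andP=> _ -> /and3P[_ _ ->].
- by rewrite last_cat !last_rcons.
- by rewrite path_edges_cat last_rcons -(cats1 r2) path_edges_cat !mem_cat fr orbT.
Qed.

(** Follow a path from [x] to [a]. If it misses [b], append [b]; otherwise stop it at [b] and append
    [a]. *)
Lemma path_via_base W a b x :
    connected_in W -> a \in W -> b \in W -> adj a b -> x \in W ->
  exists2 y, y \in W :\ x & path_via W [set a; b] x y.
Proof.
move=> cW aW bW ab xW.
have aNb : a != b by apply: contraTneq ab => ->; rewrite adj_irrefl.
have [->|xa] := eqVneq x a.
  exists b; first by rewrite !inE eq_sym aNb.
  by exists [:: b]; rewrite /= /induced_adj !inE aW bW ab aNb eqxx.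
have [->|xb] := eqVneq x b.
  exists a; first by rewrite !inE aNb.
  exists [:: a]; rewrite /= /induced_adj !inE aW bW adj_sym ab eq_sym aNb.
  by rewrite setUC eqxx.
have [p [pp up lp]] := connect_simple (cW _ _ xW aW).
have [bp|bp] := boolP (b \in p); last first.
  exists b; first by rewrite !inE eq_sym xb.
  exists (rcons p b); split.
  - by rewrite rcons_path pp lp /induced_adj aW bW.
  - by rewrite -rcons_cons rcons_uniq inE negb_or eq_sym xb bp.
  - by rewrite last_rcons.
  - by rewrite -cats1 path_edges_cat lp mem_cat inE eqxx orbT.
exists a; first by rewrite !inE eq_sym xa.
case/splitPr: bp pp up lp => p1 p2; rewrite -cat_rcons cat_path -cat_cons.
rewrite cat_uniq last_cat last_rcons => /andP[pp1 _] /and3P[up1 h _] lp.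
have ap2 : a \in p2.
  case: (p2) lp => [/= ba|u r /= <-]; last exact: mem_last.
  by rewrite ba eqxx in aNb.
have ap1 := hasPn h _ ap2.
exists (rcons (rcons p1 b) a); split.
- by rewrite rcons_path pp1 last_rcons /induced_adj aW bW adj_sym.
- by rewrite -rcons_cons rcons_uniq ap1.
- by rewrite last_rcons.
- by rewrite -cats1 path_edges_cat last_rcons mem_cat inE setUC eqxx orbT.
Qed.

(** Start with some path from [x] through the edge and move its far end to [y] along a walk avoiding
    [x], with one [path_via_step] per edge of the walk. *)
Lemma path_via_2connected W a b x y :
    connected_in W -> {in W, forall v, connected_in (W :\ v)} ->
    a \in W -> b \in W -> adj a b -> x \in W -> y \in W -> x != y ->
  path_via W [set a; b] x y.
Proof.
move=> cW cWv aW bW ab xW yW xy.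
have [y0 y0W] := path_via_base cW aW bW ab xW.
have /connectP[q + ->] : connect (induced_adj (W :\ x)) y0 y.
  by apply: cWv; rewrite // !inE eq_sym xy.
elim: q y0 {y0W} => [|u q IH] y0 //= /andP[/and3P[]].
rewrite !inE => /andP[_ y0W] /andP[ux uW] y0u uq via_y0.
apply: IH uq _; apply: path_via_step via_y0 _ ux => //; first exact: cWv.
by rewrite /induced_adj y0W uW.
Qed.

(** * Gluing two-colorings *)

(* A predicate [s] on edges encodes the coloring with two classes, [s] and its
   complement. *)
Definition linked W s k x y :=
  exists p, [/\ path (induced_adj W) x p, uniq (x :: p), last x p = y
              & count s (path_edges x p) = k].

Lemma linked0 W s x : linked W s 0 x x.
Proof. by exists [::]. Qed.

Lemma linkedS W W' s k x y :
  W \subset W' -> linked W s k x y -> linked W' s k x y.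
Proof.
by move=> sub [p [pp up lp sp]]; exists p; split=> //; apply: induced_pathS pp.
Qed.

Lemma linkedC W s k x y : linked W s k x y -> linked W s k y x.
Proof.
case=> p [pp up <- sp]; exists (rev (belast x p)); split.
- by rewrite rev_path (eq_path (e' := induced_adj W)) // => u v; rewrite induced_adj_sym.
- by move: up; rewrite lastI -rev_uniq rev_rcons.
- by case: p {pp up sp} => [|u p] //=; rewrite rev_cons last_rcons.
- by rewrite path_edges_rev count_rev.
Qed.

Lemma linked_cat A B s k l x v y :
    x \in A -> A :&: B \subset [set v] ->
    linked A s k x v -> linked B s l v y ->
  linked (A :|: B) s (k + l) x y.
Proof.
move=> xA /subsetP I [p [pp up lp sp]] [q [pq uq lq sq]].
exists (p ++ q); split; last by rewrite path_edges_cat count_cat sp lp sq.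
- rewrite cat_path lp (induced_pathS (subsetUl A B) pp).
  by rewrite (induced_pathS (subsetUr A B) pq).
- move: uq; rewrite cons_uniq => /andP[vq uq].
  rewrite -cat_cons cat_uniq up uq andbT /=.
  apply/hasPn => u uq'; apply: contraNN vq => uxp; suff /eqP<- : u == v by [].
  rewrite -in_set1 I // in_setI (induced_path_sub pq uq') andbT.
  by move: uxp; rewrite inE => /orP[/eqP->//|/(induced_path_sub pp)].
- by rewrite last_cat lp.
Qed.

Lemma eq_linked A s s' k x y :
    {in A &, forall u w, u != w -> s [set u; w] = s' [set u; w]} ->
  linked A s k x y -> linked A s' k x y.
Proof.
move=> ss [p [pp up lp <-]]; exists p; split=> // {lp}.
elim: p x pp up => [|u p IH] x //= /andP[/and3P[xA uA _] pp].
rewrite inE negb_or => /andP[/andP[xu _] up].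
by rewrite (IH u pp up) ss.
Qed.

(** [c] marks the pairs lying in neither part. On pairs inside both, [s1] wins; this is harmless
    when the parts share at most one vertex, since they then share no edge. *)
Definition glue A B s1 s2 (c : bool) : pred {set G} :=
  fun f => if f \subset A then s1 f else if f \subset B then s2 f else c.

Lemma linked_gluel A B s1 s2 c k x y :
  linked A s1 k x y -> linked A (glue A B s1 s2 c) k x y.
Proof.
by apply: eq_linked => u w uA wA _; rewrite /glue subUset !sub1set uA wA.
Qed.

Lemma linked_gluer A B s1 s2 c v k x y :
    A :&: B \subset [set v] ->
  linked B s2 k x y -> linked B (glue A B s1 s2 c) k x y.
Proof.
move=> /subsetP I; apply: eq_linked => u w uB wB uw.
rewrite /glue !subUset !sub1set uB wB /=; case: ifP => // /andP[uA wA].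
have /set1P uv := I u (introT setIP (conj uA uB)).
have /set1P wv := I w (introT setIP (conj wA wB)).
by rewrite uv wv eqxx in uw.
Qed.

(** The unmarked paths let a path with one mark be prolonged past a cut vertex or a bridge without a
    second mark. *)
Definition strong_coloring W s :=
  {in W &, forall x y, linked W s 0 x y /\ (x != y -> linked W s 1 x y)}.

(** Adjacent pairs are exempt because a single edge is itself a conflict-free path. *)
Definition weak_coloring W s :=
  {in W &, forall x y,
     linked W s 0 x y /\ (x != y -> linked W s 1 x y \/ adj x y)}.

Lemma strong_weak_coloring W s : strong_coloring W s -> weak_coloring W s.
Proof. by move=> S x y xW yW; have [? h] := S x y xW yW; split=> // /h; left. Qed.

(** A crossing path is composed at [v] and takes its mark on one side only: in [A] unless [x = v],
    and then in [B]. *)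
Lemma strong_coloring_glue W A B v s1 s2 :
    vertex_glue W A B v -> strong_coloring A s1 -> strong_coloring B s2 ->
  strong_coloring W (glue A B s1 s2 false).
Proof.
case=> U I _ S1 S2; have sub : A :&: B \subset [set v] by rewrite I.
have /setIP[vA vB] : v \in A :&: B by rewrite I set11.
set s := glue _ _ _ _ _.
have inA k x y : linked A s1 k x y -> linked W s k x y.
  by rewrite -U => /(linked_gluel B s2 false); apply: linkedS; apply: subsetUl.
have inB k x y : linked B s2 k x y -> linked W s k x y.
  by rewrite -U => /(linked_gluer s1 false sub); apply: linkedS; apply: subsetUr.
have cross x y : x \in A -> y \in B ->
    linked W s 0 x y /\ (x != y -> linked W s 1 x y).
  move=> xA yB; have [x0 x1] := S1 x v xA vA; have [y0 y1] := S2 v y vB yB.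
  have cat k l : linked A s1 k x v -> linked B s2 l v y -> linked W s (k + l) x y.
    move=> h1 h2; rewrite -U; apply: (linked_cat _ sub) => //.
      exact: linked_gluel h1.
    exact: (linked_gluer s1 false sub h2).
  split=> [|xy]; first exact: (cat 0 0).
  have [xv|xv] := eqVneq x v; last by apply: (cat 1 0) => //; apply: x1.
  by apply: (cat 0 1) => //; apply: y1; rewrite -xv.
move=> x y; rewrite -{1 2}U !in_setU => /orP[xA|xB] /orP[yA|yB].
- by have [x0 x1] := S1 x y xA yA; split=> [|/x1]; apply: inA.
- exact: cross.
- have [h0 h1] := cross y x yA xB.
  by split=> [|xy]; apply: linkedC => //; apply: h1; rewrite eq_sym.
- by have [x0 x1] := S2 x y xB yB; split=> [|/x1]; apply: inB.
Qed.

(** The bridge is a third piece with vertex set [[set a; b]], joined to [A] at [a] and to [B] at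
    [b]; [c] adds its own mark to the count. *)
Lemma linked_bridge W A B a b s1 s2 c k l x y :
    bridge_split W A B a b -> x \in A ->
    linked A s1 k x a -> linked B s2 l b y ->
  linked W (glue A B s1 s2 c) (k + c + l) x y.
Proof.
case=> U I aA bB E xA xa yb.
have bA : b \notin A by have := in_set0 b; rewrite -I in_setI bB andbT => ->.
have aB : a \notin B by have := in_set0 a; rewrite -I in_setI aA /= => ->.
have aNb : a != b by apply: contraNneq bA => <-.
have ab : linked [set a; b] (glue A B s1 s2 c) c a b.
  exists [:: b]; rewrite /= /induced_adj !set21 set22 E // !eqxx inE aNb.
  by rewrite /glue !subUset !sub1set (negbTE bA) (negbTE aB) andbF /= addn0.
have -> : W = (A :|: [set a; b]) :|: B.
  rewrite -U setUAC; apply/esym/setUidPl.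
  by rewrite subUset !sub1set !in_setU aA bB orbT.
apply: (@linked_cat _ _ _ _ _ _ b).
- by rewrite in_setU xA.
- rewrite setIUl I set0U; apply/subsetP => z; rewrite !inE.
  by case/andP=> /orP[/eqP->|//]; rewrite (negbTE aB).
- apply: (@linked_cat _ _ _ _ _ _ a) => //; last exact: linked_gluel.
  apply/subsetP => z; rewrite !inE => /andP[+ /orP[//|/eqP zb]].
  by rewrite zb (negbTE bA).
- have sub : A :&: B \subset [set a] by rewrite I sub0set.
  exact: (linked_gluer s1 c sub yb).
Qed.

(* With the bridge left unmarked, the only pair that may lack a path with one
   marked edge is the pair of ends of the bridge. *)
Lemma weak_coloring_bridge W A B a b s1 s2 :
    bridge_split W A B a b -> strong_coloring A s1 -> strong_coloring B s2 ->
  weak_coloring W (glue A B s1 s2 false).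
Proof.
move=> sp S1 S2; have [U I aA bB E] := sp.
set s := glue _ _ _ _ _.
have inA k x y : linked A s1 k x y -> linked W s k x y.
  by rewrite -U => /(linked_gluel B s2 false); apply: linkedS; apply: subsetUl.
have inB k x y : linked B s2 k x y -> linked W s k x y.
  have sub : A :&: B \subset [set a] by rewrite I sub0set.
  by rewrite -U => /(linked_gluer s1 false sub); apply: linkedS; apply: subsetUr.
have cross x y : x \in A -> y \in B ->
    linked W s 0 x y /\ (linked W s 1 x y \/ adj x y).
  move=> xA yB; have [x0 x1] := S1 x a xA aA; have [y0 y1] := S2 b y bB yB.
  have cat k l := @linked_bridge W A B a b s1 s2 false k l x y sp xA.
  split; first exact: (cat 0 0).
  have [xa|xa] := eqVneq x a; last by left; apply: (cat 1 0) => //; apply: x1.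
  have [by_|by_] := eqVneq b y; last by left; apply: (cat 0 1) => //; apply: y1.
  by right; rewrite E // xa -by_ !eqxx.
move=> x y; rewrite -{1 2}U !in_setU => /orP[xA|xB] /orP[yA|yB].
- by have [x0 x1] := S1 x y xA yA; split=> [|/x1 h]; [|left]; apply: inA.
- by have [] := cross x y xA yB.
- have [h0 h1] := cross y x yA xB; split=> [|_]; first exact: linkedC.
  by rewrite adj_sym; case: h1 => [/linkedC|]; [left|right].
- by have [x0 x1] := S2 x y xB yB; split=> [|/x1 h]; [|left]; apply: inB.
Qed.

(** For a crossing pair the bridge carries the mark and unmarked paths lead to its ends. Unmarked
    crossing paths no longer exist, so the conclusion does not speak of them. *)
Lemma weak_coloring_marked_bridge W A B a b s1 s2 :
    bridge_split W A B a b -> weak_coloring A s1 -> weak_coloring B s2 ->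
  {in W &, forall x y, x != y ->
     linked W (glue A B s1 s2 true) 1 x y \/ adj x y}.
Proof.
move=> sp S1 S2; have [U I aA bB E] := sp.
set s := glue _ _ _ _ _.
have cross x y : x \in A -> y \in B -> linked W s 1 x y.
  move=> xA yB; have [x0 _] := S1 x a xA aA; have [y0 _] := S2 b y bB yB.
  exact: (linked_bridge true sp xA x0 y0).
move=> x y; rewrite -{1 2}U !in_setU => /orP[xA|xB] /orP[yA|yB] xy.
- have [_ /(_ xy)[h|]] := S1 x y xA yA; [left|by right].
  by rewrite -U; apply: linkedS (subsetUl _ _) (linked_gluel B s2 true h).
- by left; apply: cross.
- by left; apply: linkedC; apply: cross.
- have [_ /(_ xy)[h|]] := S2 x y xB yB; [left|by right].
  have sub : A :&: B \subset [set a] by rewrite I sub0set.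
  by rewrite -U; apply: linkedS (subsetUr _ _) (linked_gluer s1 true sub h).
Qed.

(** Mark one edge. Connectedness after removal of any vertex gives paths through it, and
    bridgelessness gives paths around it. *)
Lemma strong_coloring_2connected W :
    connected_in W -> bridgeless W -> {in W, forall v, connected_in (W :\ v)} ->
  exists s, strong_coloring W s.
Proof.
move=> cW bW cWv.
have [[a [b [aW bW' ab]]]|noE] :=
    pselect (exists a b, [/\ a \in W, b \in W & adj a b]); last first.
  (* With no edge, connectedness leaves at most one vertex, and any marking works. *)
  exists predT => x y xW yW; suff -> : x = y by split; [exact: linked0 | rewrite eqxx].
  have /connectP[[|u p] //= /andP[/and3P[_ uW xu] _] _] := cW x y xW yW.
  by case: noE; exists x, u.
exists (pred1 [set a; b]) => x y xW yW; split=> [|xy]; last first.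
  have [p [pp up lp fp]] := path_via_2connected cW cWv aW bW' ab xW yW xy.
  by exists p; split=> //; rewrite count_uniq_mem ?fp // uniq_path_edges.
(* Each use of the marked edge is replaced by a detour, which exists because the edge is no
   bridge. *)
have : connect (adj_without W a b) x y.
  apply: (connect_homo (f := id)) (cW x y xW yW) => u w uw.
  have [/eqP E|ne] := boolP ([set u; w] == [set a; b]); last first.
    by apply: connect1; rewrite /adj_without uw.
  suff -> : adj_without W a b = adj_without W u w.
    by case/and3P: uw => uW wW uw; apply: bW.
  by apply/funext => z; apply/funext => t; rewrite /adj_without E.
case/connect_simple=> p [pp up lp]; exists p; split=> //.
  by apply: sub_path pp => u w /andP[].
elim: p x pp {up lp xW} => [|u p IH] x //= /andP[/andP[_ /negbTE->] up].
exact: IH.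
Qed.

(** Induction on [#|W|], splitting at cut vertices until none is left; both parts inherit
    connectedness and bridgelessness. *)
Lemma bridgeless_strong_coloring W :
  connected_in W -> bridgeless W -> exists s, strong_coloring W s.
Proof.
have [n] := ubnP #|W|; elim: n W => // n IH W; rewrite ltnS => Wn cW bW.
have [|] := pselect {in W, forall v, connected_in (W :\ v)}.
  exact: strong_coloring_2connected.
move=> /existsNP[v /not_implyP[vW cWv]].
have [A [B [g An Bn]]] := not_connected_in_glue cW vW cWv.
have [cA bA] := vertex_glue_side g cW bW.
have [cB bB] := vertex_glue_side (vertex_glueC g) cW bW.
have [s1 S1] := IH A (leq_trans An Wn) cA bA.
have [s2 S2] := IH B (leq_trans Bn Wn) cB bB.
by exists (glue A B s1 s2 false); apply: strong_coloring_glue g S1 S2.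
Qed.

(** * Counting bridges *)

(** Each edge leaving [W] is counted once, directed outwards. *)
Definition boundary W : {set G * G} :=
  [set e | [&& e.1 \in W, e.2 \notin W & adj e.1 e.2]].

Lemma bridge_split_card W A B a b :
  bridge_split W A B a b -> #|W| = #|A| + #|B|.
Proof. by case=> <- I _ _ _; rewrite cardsU I cards0 subn0. Qed.

(** Apart from the bridge, every edge leaving [A] also leaves [W]. *)
Lemma bridge_split_boundary W A B a b :
  bridge_split W A B a b -> #|boundary A| <= #|boundary W|.+1.
Proof.
case=> U I aA bB E; rewrite -add1n -(cards1 (a, b)).
apply: leq_trans (subset_leq_card _) (leq_card_setU _ _).
apply/subsetP => -[u w]; rewrite !inE /= => /and3P[uA wA uw].
have [wB|wB] := boolP (w \in B); first by rewrite xpair_eqE -E // uw.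
by rewrite -U !inE uA uw negb_or wA wB orbT.
Qed.

Lemma boundary_card W :
  #|boundary W| = \sum_(x in W) #|[set y | adj x y] :\: W|.
Proof.
rewrite -sum1_card; under [RHS]eq_bigr do rewrite -sum1_card.
rewrite pair_big_dep /=; apply: eq_bigl => -[u w].
by rewrite !inE.
Qed.

(** If [w = #|W| <= d], each vertex of [W] has at least [d + 1 - w] neighbours outside, so the
    boundary has at least [w * (d + 1 - w) >= d >= 4] edges. *)
Lemma small_boundary_card W d :
    (forall x, d <= deg x) -> 4 <= d -> W != set0 -> #|boundary W| <= 3 ->
  d < #|W|.
Proof.
move=> degd d4; rewrite -card_gt0 => W0 bW; rewrite ltnNge; apply/negP => Wd.
have : \sum_(x in W) d <= \sum_(x in W) (#|W|.-1 + #|[set y | adj x y] :\: W|).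
  apply: leq_sum => x xW; apply: leq_trans (degd x) _.
  rewrite /deg -(cardsID W) leq_add2r (cardsD1 x W) xW /= subset_leq_card //.
  apply/subsetP => y; rewrite !inE => /andP[xy ->].
  by rewrite andbT; apply: contraTneq xy => ->; rewrite adj_irrefl.
rewrite big_split /= -boundary_card !sum_nat_const; nia.
Qed.

(** Three bridges, cut one after another, would leave four parts with boundary at most 3, hence with
    at least [d + 1] vertices each: [4 * d + 4] in all, too many. *)
Lemma two_colorable d :
    connected G -> (forall x, d <= deg x) -> 4 <= d -> #|G| <= 4 * d + 3 ->
  exists s, forall x y, x != y -> linked [set: G] s 1 x y \/ adj x y.
Proof.
move=> Gconn degd d4 nd.
have cV : connected_in [set: G].
  move=> x y _ _; apply: (connect_homo (f := id)) (Gconn x y) => u w uw.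
  by apply: connect1; rewrite /induced_adj !inE.
have bV : #|boundary [set: G]| = 0.
  by apply: eq_card0 => e; rewrite !inE.
have card_ge A a : a \in A -> #|boundary A| <= 3 -> d < #|A|.
  by move=> aA; apply: small_boundary_card => //; apply/set0Pn; exists a.
have side_data W A B a b : bridge_split W A B a b -> connected_in W ->
    [/\ connected_in A, connected_in B, #|W| = #|A| + #|B|,
        #|boundary A| <= #|boundary W|.+1 & #|boundary B| <= #|boundary W|.+1].
  move=> sp cW; have sp' := bridge_splitC sp.
  split; [exact: bridge_split_side sp cW | exact: bridge_split_side sp' cW
    | exact: bridge_split_card sp | exact: bridge_split_boundary sp
    | exact: bridge_split_boundary sp'].
have [/(bridgeless_strong_coloring cV)[s S]|] := pselect (bridgeless [set: G]).
  by exists s => x y xy; left; have [_] := S x y (in_setT _) (in_setT _); apply.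
move=> /not_bridgeless_split[A [B [a [b sp]]]].
(* Treats a first bridge with one bridgeless side [A']: it gets marked, and a second bridge, inside
   [B'], stays unmarked. *)
have main A' B' a' b' : bridge_split [set: G] A' B' a' b' -> bridgeless A' ->
    exists s, forall x y, x != y -> linked [set: G] s 1 x y \/ adj x y.
  move=> {A B a b} {}sp bA.
  have [cA cB card_AB bdA bdB] := side_data _ _ _ _ _ sp cV.
  have [U I aA bB E] := sp.
  have [s1 S1] := bridgeless_strong_coloring cA bA.
  suff [s2 S2] : exists s2, weak_coloring B' s2.
    exists (glue A' B' s1 s2 true) => x y.
    apply: weak_coloring_marked_bridge sp _ S2 x y (in_setT _) (in_setT _).
    exact: strong_weak_coloring.
  have [/(bridgeless_strong_coloring cB)[s2 S2]|] := pselect (bridgeless B').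
    by exists s2; apply: strong_weak_coloring.
  move=> /not_bridgeless_split[C [D [c [e spB]]]].
  (* A third bridge, inside [C'], would give the four parts [A'], [D'], [C1] and [C2]. *)
  have part C' D' c' e' : bridge_split B' C' D' c' e' -> bridgeless C'.
    move=> {spB C D c e} spB; apply: contrapT => /not_bridgeless_split.
    move=> [C1 [C2 [c1 [c2 spC]]]].
    have [cC cD card_CD bdC bdD] := side_data _ _ _ _ _ spB cB.
    have [_ _ card_C bdC1 bdC2] := side_data _ _ _ _ _ spC cC.
    have [_ _ c'C e'D _] := spB; have [_ _ c1C c2C _] := spC.
    have := card_ge _ _ aA; have := card_ge _ _ e'D.
    have := card_ge _ _ c1C; have := card_ge _ _ c2C.
    by move: card_AB; rewrite cardsT; lia.
  have [cC cD _ _ _] := side_data _ _ _ _ _ spB cB.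
  have [s2 S2] := bridgeless_strong_coloring cC (part _ _ _ _ spB).
  have [s3 S3] := bridgeless_strong_coloring cD (part _ _ _ _ (bridge_splitC spB)).
  by exists (glue C D s2 s3 false); apply: weak_coloring_bridge spB S2 S3.
have [|nbA] := pselect (bridgeless A); first exact: main sp.
have [|nbB] := pselect (bridgeless B); first exact: main (bridge_splitC sp).
(* Bridges on both sides would give the four parts [A1], [A2], [B1] and [B2]. *)
have [cA cB card_AB bdA bdB] := side_data _ _ _ _ _ sp cV.
have [A1 [A2 [a1 [a2 spA]]]] := not_bridgeless_split nbA.
have [B1 [B2 [b1 [b2 spB]]]] := not_bridgeless_split nbB.
have [_ _ card_A bdA1 bdA2] := side_data _ _ _ _ _ spA cA.
have [_ _ card_B bdB1 bdB2] := side_data _ _ _ _ _ spB cB.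
have [_ _ a1A a2A _] := spA; have [_ _ b1B b2B _] := spB.
have := card_ge _ _ a1A; have := card_ge _ _ a2A.
have := card_ge _ _ b1B; have := card_ge _ _ b2B.
by move: card_AB; rewrite cardsT; lia.
Qed.

(** * From markings to the conflict-free connection number *)

Lemma min_deg_le x : min_deg G <= deg x.
Proof.
rewrite /min_deg; elim: index_enum (mem_index_enum x) => // z r IH.
rewrite inE big_cons => /orP[/eqP<-|/IH]; first exact: geq_minl.
exact/leq_trans/geq_minr.
Qed.

Lemma colorable2 s :
    (forall x y, x != y -> linked [set: G] s 1 x y \/ adj x y) ->
  cf_connection_colorable G 2.
Proof.
move=> S; exists (fun f => s f : nat) => [f _|x y xy]; first by case: (s f).
have [[p [pp up lp sp]]|axy] := S x y xy.
  exists p; first by split=> //; apply: sub_path pp => u w /and3P[].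
  exists 1; rewrite count_map -[RHS]sp; apply: eq_count => f /=.
  by case: (s f).
exists [:: y]; first by split; rewrite //= ?axy // inE xy.
by exists (s [set x; y] : nat); rewrite /= eqxx.
Qed.

(** With at most one color available, a color used exactly once on a path forces the path to be a
    single edge. *)
Lemma colorable_lt2_complete k :
  k < 2 -> cf_connection_colorable G k -> complete G.
Proof.
move=> k2 [c ck cP] x y xy; have [p [pp up lp] [l]] := cP x y xy.
have c0 : {in path_edges x p, forall f, c f = 0}.
  move=> f fp; suff /ck : f \in edge_set G by lia.
  elim: p x pp fp {xy up lp} => [|u p IH] x //= /andP[xu pp].
  rewrite inE => /orP[/eqP->|/(IH _ pp)//].
  by rewrite inE; apply/existsP; exists x; apply/existsP; exists u; rewrite xu eqxx.
rewrite count_map (eq_in_count (a2 := fun=> 0 == l)) => [|f /c0 /= ->] //.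
case: (0 == l); last by rewrite count_pred0.
rewrite count_predT size_pairmap => p1.
by case: p lp pp p1 {up c0} => [|u [|]] //= ->; rewrite andbT.
Qed.

End Graph.

Local Open Scope ring_scope.

Theorem theorem4p4 (G : sgraph) (Gconn : connected G)
    (Gnoncomplete : ~ complete G)
    (order_ge16 : (16 <= #|G|)%N)
    (min_deg_ge : (#|G|%:R - 3) / 4 <= (min_deg G)%:R :> rat) :
  cfc Gconn = 2%N.
Proof.
have n_le : (#|G| <= 4 * min_deg G + 3)%N.
  by rewrite -(ler_nat rat) natrD natrM; move: min_deg_ge; lra.
(* By integrality, [n_le] and [order_ge16] force [min_deg G] to be at least 4. *)
have [s S] := two_colorable Gconn (@min_deg_le G) ltac:(lia) n_le.
rewrite /cfc; case: ex_minnP => k /asboolP kP /(_ 2%N).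
have /asboolP-> := colorable2 S; move=> /(_ isT) k2.
apply/eqP; rewrite eqn_leq k2 leqNgt; apply/negP => k_lt2.
exact/Gnoncomplete/colorable_lt2_complete/kP.
Qed.
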